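(* Let $\mathcal X$ be a finite set, let $\mu$ be a probability measure on $\mathcal X$ with $\mu(x)>0$ for all $x$, let $d(x,y)=\mathbf 1_{x\ne y}$, and let $L$ be the generator $L(z,z')=\mu(z')$ for $z\neq z'$, $L(z,z)=-(1-\mu(z))$. For all probability measures $\nu_0,\nu_1$ on $\mathcal X$, with associated zero-temperature coupling $\widehat\pi$ and Schrödinger bridge at zero temperature $(\widehat Q_t)_{t\in[0,1]}$ from $\nu_0$ to $\nu_1$, one has for all $t\in(0,1)$ $$H(\widehat Q_t|\mu)\le(1-t)H(\nu_0|\mu)+tH(\nu_1|\mu)-\frac{t(1-t)}2\,C_t(\widehat\pi),$$ where $$C_t(\widehat\pi)=\int h_t\Big(\int\mathbf 1_{w\ne x}\,d\widehat\pi_{\rightarrow}(w|x)\Big)d\nu_0(x)+\int h_{1-t}\Big(\int\mathbf 1_{w\ne y}\,d\widehat\pi_{\leftarrow}(w|y)\Big)d\nu_1(y),$$ and, for $t\in(0,1)$, $u\ge0$, $$h_t(u)=\frac{t\,h(u)-h(tu)}{t(1-t)},\qquad h(u)=\begin{cases}2[(1-u)\log(1-u)+u]&0\le u\le1,\\+\infty&u>1.\end{cases}$$ Moreover, $$C_t(\widehat\pi)\ \ge\ (1+W_1(\nu_0,\nu_1))\;k_t\!\left(\frac{W_1(\nu_0,\nu_1)}{1+W_1(\nu_0,\nu_1)}\right),$$ where for $v\in[0,1/2]$ $$k_t(v)=\inf_{\alpha,\beta>0,\ \alpha+\beta\le1}\Big\{\alpha h_t\Big(\frac v\alpha\Big)+\beta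 h_{1-t}\Big(\frac v\beta\Big)\Big\}\ \ge\ \frac{4v^2}{1-v}.$$
   Context: $H(q|\mu)=\sum_z q(z)\log\frac{q(z)}{\mu(z)}$, with $0\log0=0$. By convention $h_t(u)=+\infty$ for $u>1$. $W_1(\nu_0,\nu_1)=\inf_\pi\iint d(x,y)\,d\pi(x,y)$, the infimum being over couplings of $\nu_0,\nu_1$; here $W_1(\nu_0,\nu_1)=\frac12\|\nu_0-\nu_1\|_{TV}$ with $\|\nu_0-\nu_1\|_{TV}=2\sup_{A\subset\mathcal X}|\nu_0(A)-\nu_1(A)|$. Zero-temperature coupling and bridge. For $\gamma>0$, $t\ge0$ let $P_t^\gamma=e^{\gamma tL}$ and $P_t^\gamma f(x)=\sum_yP_t^\gamma(x,y)f(y)$. Let $f^\gamma,g^\gamma\ge0$ solve $f^\gamma(x)\,P_1^\gamma g^\gamma(x)=\nu_0(x)/\mu(x)$ and $g^\gamma(y)\,P_1^\gamma f^\gamma(y)=\nu_1(y)/\mu(y)$ for all $x,y$, and set $\widehat\pi^\gamma(x,y)=\mu(x)P_1^\gamma(x,y)f^\gamma(x)g^\gamma(y)$; this is a uniquely determined coupling of $\nu_0,\nu_1$ (the minimizer of the relative entropy with respect to $\mu(x)P_1^\gamma(x,y)$ among couplings of $\nu_0$ and $\nu_1$). It is known (Léonard) that as $\gamma\to0$, $\widehat\pi^\gamma$ converges to a coupling $\widehat\pi$ of $\nu_0,\nu_1$, which is $W_1$-optimal. The kernels are $\widehat\pi_\rightarrow(w|x)=\widehat\pi(x,w)/\nu_0(x)$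 for $\nu_0(x)>0$ and $\widehat\pi_\leftarrow(w|y)=\widehat\pi(w,y)/\nu_1(y)$ for $\nu_1(y)>0$. The bridge is $\widehat Q_t=\sum_{x,y}Q_t^{x,y}\,\widehat\pi(x,y)$ with $Q_t^{x,y}=(1-t)\delta_x+t\delta_y$, i.e. $\widehat Q_t=(1-t)\nu_0+t\nu_1$. *)

(* Defs.v *)
From HB Require Import structures.
From mathcomp Require Import all_boot all_order all_algebra.
From mathcomp Require Import all_classical all_reals all_analysis.

Set Implicit Arguments.
Unset Strict Implicit.
Unset Printing Implicit Defensive.

Import Order.TTheory GRing.Theory Num.Theory.
Import numFieldNormedType.Exports.

Local Open Scope classical_set_scope.
Local Open Scope ring_scope.

(** Measures on the finite set [X] are given by their mass functions [X -> R],
    measures on [X * X] and kernels (matrices indexed by [X]) by curried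
    functions [X -> X -> R]. *)

Section Measures.
Context {R : realType} {X : finType}.
Implicit Types (q mu nu : X -> R) (pi : X -> X -> R).

Definition is_prob q : Prop := (forall x, 0 <= q x) /\ \sum_x q x = 1.

(* [0 log 0 = 0] holds because the summand has the factor [q z]. *)
Definition rel_entropy q mu : R := \sum_z q z * ln (q z / mu z).

Definition is_coupling nu0 nu1 pi : Prop :=
  [/\ forall x y, 0 <= pi x y,
      forall x, \sum_y pi x y = nu0 x
    & forall y, \sum_x pi x y = nu1 y].

Definition dist (x y : X) : R := (x != y)%:R.

Definition W1 nu0 nu1 : R :=
  inf [set c | exists2 pi, is_coupling nu0 nu1 pi
                         & c = \sum_x \sum_y dist x y * pi x y].

End Measures.

Section Semigroup.
Context {R : realType} {X : finType}.
Implicit Types (A B : X -> X -> R) (mu f : X -> R).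

Definition ker_mul A B : X -> X -> R := fun x y => \sum_z A x z * B z y.

Definition ker_id : X -> X -> R := fun x y => (x == y)%:R.

Definition ker_pow A (k : nat) : X -> X -> R := iter k (ker_mul A) ker_id.

(* Matrix exponential, as the entrywise sum of the exponential series. *)
Definition ker_exp A : X -> X -> R := fun x y =>
  limn (fun n => \sum_(0 <= k < n) ker_pow A k x y / k`!%:R).

Definition ker_app A f : X -> R := fun x => \sum_y A x y * f y.

Definition generator mu : X -> X -> R := fun z z' =>
  if z == z' then - (1 - mu z) else mu z'.

Definition semigroup mu (gamma t : R) : X -> X -> R :=
  ker_exp (fun x y => gamma * t * generator mu x y).

End Semigroup.

Section ZeroTemperature.
Context {R : realType} {X : finType}.
Implicit Types (mu nu f g : X -> R) (pi : X -> X -> R).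

Definition schrodinger_system mu nu0 nu1 (gamma : R) f g : Prop :=
  [/\ forall x, 0 <= f x,
      forall y, 0 <= g y,
      forall x, f x * ker_app (semigroup mu gamma 1) g x = nu0 x / mu x
    & forall y, g y * ker_app (semigroup mu gamma 1) f y = nu1 y / mu y].

Definition schrodinger_coupling mu (gamma : R) f g : X -> X -> R :=
  fun x y => mu x * semigroup mu gamma 1 x y * f x * g y.

(* [pi] is the limit, as the temperature [gamma] decreases to 0, of the
   entropic couplings of [nu0] and [nu1]. The pairs [(f gamma, g gamma)] are
   not unique, but the couplings they define, hence [pi], are. *)
Definition zero_temperature_coupling mu nu0 nu1 pi : Prop :=
  exists f g : R -> X -> R,
    (forall gamma, 0 < gamma ->
       schrodinger_system mu nu0 nu1 gamma (f gamma) (g gamma)) /\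
    (forall x y,
       schrodinger_coupling mu gamma (f gamma) (g gamma) x y
         @[gamma --> 0^'+] --> pi x y).

(* Only meaningful where [0 < nu0 x], resp. [0 < nu1 y]. *)
Definition ker_fwd nu0 pi (w x : X) : R := pi x w / nu0 x.
Definition ker_bwd nu1 pi (w y : X) : R := pi w y / nu1 y.

Definition dirac_bridge (t : R) (x y : X) : X -> R := fun z =>
  (1 - t) * (z == x)%:R + t * (z == y)%:R.

Definition bridge pi (t : R) : X -> R := fun z =>
  \sum_x \sum_y dirac_bridge t x y z * pi x y.

End ZeroTemperature.

Section Costs.
Context {R : realType}.
Local Open Scope ereal_scope.

(* At [u = 1], [(1 - u) * ln (1 - u) = 0]. *)
Definition h (u : R) : \bar R :=
  if (u <= 1)%R then (2 * ((1 - u) * ln (1 - u) + u))%:E else +oo.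

(* The formula would read [+oo - +oo] when [t * u > 1]; by convention
   [ht t u = +oo] for all [u > 1]. *)
Definition ht (t u : R) : \bar R :=
  if (u <= 1)%R then (t%:E * h u - h (t * u)) * ((t * (1 - t))^-1)%:E
  else +oo.

Definition kt (t v : R) : \bar R :=
  ereal_inf [set c | exists a b : R,
    [/\ (0 < a)%R, (0 < b)%R, (a + b <= 1)%R
      & c = a%:E * ht t (v / a) + b%:E * ht (1 - t) (v / b)]].

Definition Ct {X : finType} (nu0 nu1 : X -> R) (pi : X -> X -> R) (t : R) :
    \bar R :=
  \sum_(x | (0 < nu0 x)%R)
     ht t (\sum_w (w != x)%:R * ker_fwd nu0 pi w x)%R * (nu0 x)%:E
  + \sum_(y | (0 < nu1 y)%R)
     ht (1 - t) (\sum_w (w != y)%:R * ker_bwd nu1 pi w y)%R * (nu1 y)%:E.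

End Costs.

(* Main.v *)
Require Import Defs.
From HB Require Import structures.
From mathcomp Require Import all_boot all_order all_algebra.
From mathcomp Require Import all_classical all_reals all_analysis.
From mathcomp Require Import ring lra.

(** Write [p] and [q] for the two marginals, [w] for their transport cost and
    [r = (1 - t) p + t q] for the bridge.

    Everything about the zero-temperature coupling that matters is its
    diagonal. Off the diagonal the kernel [P_1^gamma] has product form
    [(1 - e^-gamma) mu y], while its diagonal entries stay at least [e^-gamma].
    Hence the two moves [x -> y] and [z -> x] together are cheaper when replaced
    by [x -> x] and [z -> y]: the product of the masses of the former pair is at
    most [(1 - e^-gamma) / e^-gamma] times the product of the latter
    ([schrodinger_coupling_exchange]). In the limit no site both sends and
    receives mass, which forces [pihat x x = min (p x) (q x)]
    ([zero_temperature_diag]); in particular [pihat] is optimal and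
    [w = sum_x (p x - min (p x) (q x))] ([W1E]).

    With this diagonal, [t (1 - t) / 2 * C_t] is exactly the sum over [x] of the
    Jensen gap of [s |-> s log s] between [p x] and [q x]: the function [h_t] is
    the perspective of that gap ([htE], [CtE]). The Jensen gap is insensitive to
    the reference measure [mu], because [mu] enters the entropy through a linear
    term, so its sum is also the convexity defect of the relative entropy along
    the bridge ([rel_entropy_gap]). The first inequality is thus an equality.

    The Jensen gap is convex and homogeneous of degree one in the pair [(p, q)]
    by the log-sum inequality. Merging all sites with [p > q] into one, and all
    sites with [p < q] into another, leaves two masses [A] and [B] which differ
    from their counterparts by [w] and satisfy
    [A + B <= sum_x max (p x) (q x) = 1 + w]; this is an admissible choice of
    [(1 + w) alpha] and [(1 + w) beta] in the infimum [k_t]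
    ([jensen_gap_ge_kt]).

    Finally, the expression minimised in [k_t v] is [2 / (t (1 - t))] times a
    weighted Jensen-Shannon divergence of two measures on two points, [(alpha, beta - v)] and
    [(alpha - v, beta)], whose common mass is at most [1 - v]. Pinsker's
    inequality, applied to each of them against their mixture, bounds it below
    by [4 v^2 / (1 - v)] ([jensen_gap_pinsker], [kt_ge]). *)

Set Implicit Arguments.
Unset Strict Implicit.
Unset Printing Implicit Defensive.

Import Order.TTheory GRing.Theory Num.Theory.
Import numFieldNormedType.Exports.

Local Open Scope ring_scope.

(** * Logarithmic inequalities *)

Section RealInequalities.
Context {R : realType}.
Implicit Types a b c d t u v x y : R.

(** The two sides agree at [x = 1], and the derivative of their difference is
    [(x - 1)^3 / (x^2 (x + 2)^2)], which has the sign of [x - 1]. The left-hand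
    side is the partial fraction form of the bound that makes [xlnx_ge] sharp
    enough for Pinsker's inequality. *)
Lemma ln_ge_rational x : 0 < x ->
  5 / 2 - (4 * x)^-1 - 27 / 4 * (x + 2)^-1 <= ln x.
Proof.
move=> x0.
pose F := fun y : R => ln y + 4^-1 * y^-1 + 27 / 4 * (y + 2)^-1.
pose dF := fun y : R => (y - 1) ^+ 3 / (y ^+ 2 * (y + 2) ^+ 2).
have dFE y : 0 < y -> is_derive y 1 F (dF y).
  move=> y0; have hln := is_derive1_ln y0.
  have yn0 : y != 0 by rewrite gt_eqF.
  have y2n0 : y + 2 != 0 by rewrite gt_eqF// addr_gt0.
  have := @is_deriveV R id y 1 1 yn0 (is_derive_id _ _) => h1.
  have h3 : is_derive y 1 (fun y : R => y + 2) 1.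
    by apply: is_derive_eq; rewrite addr0.
  have h2 := @is_deriveV R (fun y : R => y + 2) y 1 1 y2n0 h3.
  rewrite /F; apply: is_derive_eq; rewrite /dF /GRing.scale /=.
  by field; rewrite yn0 y2n0.
have Fc a b : 0 < a -> {within `[a, b], continuous F}%classic.
  move=> a0; apply: derivable_within_continuous => y; rewrite in_itv /=.
  by move=> /andP[ay _]; case: (dFE y (lt_le_trans a0 ay)).
have F1 : F 1 = 5 / 2 by rewrite /F ln1; field.
suff : F 1 <= F x.
  by rewrite F1 /F invfM; set l := ln x; lra.
have [x1|x1] := leP 1 x.
  have [c|c] := @MVT_segment R F dF 1 x x1 _ (Fc _ _ ltr01).
    rewrite in_itv /= => /andP[c1 _].
    by apply: dFE; rewrite (lt_trans ltr01).
  rewrite in_itv /= => /andP[c1 _] FE.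
  rewrite -subr_ge0 FE mulr_ge0 ?subr_ge0// /dF.
  by rewrite divr_ge0 ?exprn_ge0 ?subr_ge0// mulr_ge0// exprn_even_ge0.
have [c|c] := @MVT_segment R F dF x 1 (ltW x1) _ (Fc _ _ x0).
  rewrite in_itv /= => /andP[c1 _].
  by apply: dFE; rewrite (lt_trans x0).
rewrite in_itv /= => /andP[_ c1] FE.
rewrite -subr_le0 FE mulr_le0_ge0 ?subr_ge0 ?(ltW x1)// /dF.
rewrite mulr_le0_ge0//; last by rewrite invr_ge0 mulr_ge0// exprn_even_ge0.
by rewrite exprS mulr_le0_ge0 ?subr_le0// exprn_even_ge0.
Qed.

(** The relative entropy summand exceeds its tangent line by a quadratic term.
    The weights in [a + 2 * b] make the two sides agree to third order at
    [a = b]. *)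
Lemma xlnx_ge a b : 0 <= a -> 0 < b ->
  a - b + 3 / 2 * (a - b) ^+ 2 / (a + 2 * b) <= a * ln (a / b).
Proof.
rewrite le_eqVlt => /predU1P[<-|a0] b0.
  rewrite mul0r !add0r sqrrN.
  have -> : 3 / 2 * b ^+ 2 / (2 * b) = 3 / 4 * b by field; rewrite gt_eqF.
  lra.
have := ln_ge_rational (divr_gt0 a0 b0).
rewrite -(ler_pM2l a0); apply: le_trans; rewrite le_eqVlt; apply/orP; left.
apply/eqP; field.
by rewrite !gt_eqF// addr_gt0// mulr_gt0.
Qed.

Lemma xlnx_ge_sub a b : 0 <= a -> 0 < b -> a - b <= a * ln (a / b).
Proof.
move=> a0 b0; apply: le_trans (xlnx_ge a0 b0); rewrite lerDl.
by apply: divr_ge0; [rewrite mulr_ge0// sqr_ge0|rewrite addr_ge0// mulr_ge0// ltW].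
Qed.

Lemma xlnx_chain a b c : 0 <= a -> 0 < b -> 0 < c ->
  a * ln (a / c) = a * ln (a / b) + a * ln (b / c).
Proof.
rewrite le_eqVlt => /predU1P[<-|a0] b0 c0; first by rewrite !mul0r addr0.
by rewrite !ln_div ?posrE//; ring.
Qed.

(** Pinsker's inequality on two points. The quadratic remainders of [xlnx_ge]
    are combined by the harmonic-arithmetic mean inequality for their
    denominators, which add up to three times the total mass. *)
Lemma pinsker2 a b c d : 0 <= a -> 0 <= b -> 0 < c -> 0 < d -> a + b = c + d ->
  2 * (a - c) ^+ 2 / (a + b) <= a * ln (a / c) + b * ln (b / d).
Proof.
move=> a0 b0 c0 d0 e.
apply: le_trans (lerD (xlnx_ge a0 c0) (xlnx_ge b0 d0)).
have -> : b = c + d - a by lra.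
set s := a - c.
have -> : c + d - a - d = - s by rewrite /s; ring.
set A := a + 2 * c; set B := c + d - a + 2 * d.
have A0 : 0 < A by rewrite /A; lra.
have B0 : 0 < B by rewrite /B; lra.
have -> : a + (c + d - a) = (A + B) / 3 by rewrite /A /B; field.
rewrite sqrrN.
have -> : s + 3 / 2 * s ^+ 2 / A + (- s + 3 / 2 * s ^+ 2 / B) =
   3 / 2 * s ^+ 2 * (A^-1 + B^-1) by ring.
have -> : 2 * s ^+ 2 / ((A + B) / 3) = 3 / 2 * s ^+ 2 * (4 / (A + B)).
  by field; rewrite gt_eqF// addr_gt0.
apply: ler_wpM2l; first by rewrite mulr_ge0// sqr_ge0.
rewrite -subr_ge0.
have -> : A^-1 + B^-1 - 4 / (A + B) = (A - B) ^+ 2 / (A * B * (A + B)).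
  by field; rewrite !gt_eqF// addr_gt0.
by rewrite divr_ge0 ?sqr_ge0// ltW// !mulr_gt0// addr_gt0.
Qed.

(** Each summand lies above the tangent line at the ratio [A / B] of the totals,
    and the linear corrections [a i - b i * (A / B)] sum to zero. *)
Lemma log_sum (I : finType) (P : pred I) (a b : I -> R) :
  (forall i, P i -> 0 <= a i) -> (forall i, P i -> 0 < b i) ->
  (\sum_(i | P i) a i) * ln ((\sum_(i | P i) a i) / (\sum_(i | P i) b i)) <=
  \sum_(i | P i) a i * ln (a i / b i).
Proof.
move=> a0 b0; set A := \sum_(i | P i) a i; set B := \sum_(i | P i) b i.
have le_sum (F : I -> R) i : (forall i, P i -> 0 <= F i) -> P i ->
    F i <= \sum_(i | P i) F i.
  move=> F0 Pi; rewrite (bigD1 i)//= lerDl sumr_ge0// => j /andP[Pj _].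
  exact: F0.
have pointwise i : P i ->
    a i * ln (A / B) + (a i - b i * (A / B)) <= a i * ln (a i / b i).
  move=> Pi; have aA : a i <= A by exact: le_sum.
  have bB : b i <= B by apply: le_sum => // j /b0/ltW.
  have bi := b0 _ Pi; have B0 := lt_le_trans bi bB.
  have := a0 _ Pi; rewrite le_eqVlt => /predU1P[<-|ai].
    rewrite !mul0r !add0r oppr_le0 mulr_ge0 ?(ltW bi)// divr_ge0 ?(ltW B0)//.
    exact: sumr_ge0.
  have A0 := lt_le_trans ai aA; have AB0 : 0 < A / B by exact: divr_gt0.
  rewrite (@xlnx_chain _ (b i * (A / B)))//; [|exact: ltW|exact: mulr_gt0].
  rewrite -[b i * _ / b i]mulrAC divff ?gt_eqF// mul1r addrC lerD2r.
  by apply: xlnx_ge_sub; [exact: ltW|exact: mulr_gt0].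
apply: le_trans (ler_sum _ pointwise).
rewrite big_split /= -mulr_suml -/A sumrB -/A -mulr_suml -/B.
rewrite lerDl subr_ge0.
have [->|B0] := eqVneq B 0; first by rewrite mul0r; exact: sumr_ge0.
by rewrite mulrC divfK.
Qed.

End RealInequalities.

(** * The Jensen gap of [s log s] *)

Section JensenGap.
Context {R : realType}.
Implicit Types a b c d t u v x y : R.

(** Writing the gap relative to the mixture [r] displays it as a weighted
    Jensen-Shannon divergence: both terms are relative entropy summands, to
    which log-sum and Pinsker apply. [jensen_gapE] gives the usual form. *)
Definition jensen_gap t a b : R :=
  let r := (1 - t) * a + t * b in
  (1 - t) * (a * ln (a / r)) + t * (b * ln (b / r)).

Lemma onem01 t : 0 < t < 1 -> 0 < 1 - t < 1.
Proof. by move=> /andP[t0 t1]; rewrite subr_gt0 t1 gtrBl. Qed.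

Lemma mix_ge0 t a b : 0 < t < 1 -> 0 <= a -> 0 <= b ->
  0 <= (1 - t) * a + t * b.
Proof.
move=> t01 a0 b0; have /andP[s0 _] := onem01 t01; case/andP: t01 => t0 _.
by rewrite addr_ge0// mulr_ge0// ltW.
Qed.

Lemma mix_gt0 t a b : 0 < t < 1 -> 0 <= a -> 0 <= b -> (0 < a) || (0 < b) ->
  0 < (1 - t) * a + t * b.
Proof.
move=> t01 a0 b0; have /andP[s0 _] := onem01 t01; case/andP: t01 => t0 _.
move=> /orP[ap|bp].
  by rewrite ltr_wpDr// ?mulr_gt0// mulr_ge0// ltW.
by rewrite ltr_wpDl// ?mulr_gt0// mulr_ge0// ltW.
Qed.

Lemma jensen_gap_refl t a : jensen_gap t a a = 0.
Proof.
rewrite /jensen_gap -!mulrDl !subrK !mul1r.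
have [->|a0] := eqVneq a 0; first by rewrite mul0r.
by rewrite divff// ln1 mulr0.
Qed.

Lemma jensen_gap_sym t a b : jensen_gap (1 - t) b a = jensen_gap t a b.
Proof.
rewrite /jensen_gap.
have -> : (1 - (1 - t)) * b + (1 - t) * a = (1 - t) * a + t * b by ring.
by rewrite addrC; congr (_ + _ * _); ring.
Qed.

(** Changing the reference [c] adds to [s log (s / c)] a linear function of [s],
    which has no Jensen gap. *)
Lemma jensen_gapE t a b c : 0 < t < 1 -> 0 <= a -> 0 <= b -> 0 < c ->
  jensen_gap t a b = (1 - t) * (a * ln (a / c)) + t * (b * ln (b / c))
    - ((1 - t) * a + t * b) * ln (((1 - t) * a + t * b) / c).
Proof.
move=> t01 a0 b0 c0.
have [|] := boolP ((0 < a) || (0 < b)).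
  move=> /(mix_gt0 t01 a0 b0) r0; rewrite /jensen_gap.
  set r := (1 - t) * a + t * b in r0 *.
  rewrite (xlnx_chain a0 r0 c0) (xlnx_chain b0 r0 c0).
  by move: (ln (a / r)) (ln (b / r)) (ln (r / c)) => u v w; rewrite /r; ring.
rewrite negb_or -!leNgt => /andP[a0' b0'].
have -> : a = 0 by apply: le_anti; rewrite a0 a0'.
have -> : b = 0 by apply: le_anti; rewrite b0 b0'.
by rewrite jensen_gap_refl !(mul0r, mulr0, addr0, subr0).
Qed.

Lemma jensen_gap_ge0 t a b : 0 < t < 1 -> 0 <= a -> 0 <= b ->
  0 <= jensen_gap t a b.
Proof.
move=> t01 a0 b0; have /andP[s0 _] := onem01 t01; have /andP[t0 _] := t01.
have [|] := boolP ((0 < a) || (0 < b)).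
  move=> /(mix_gt0 t01 a0 b0); rewrite /jensen_gap.
  set r := (1 - t) * a + t * b => r0.
  apply: le_trans (lerD (ler_wpM2l (ltW s0) (xlnx_ge_sub a0 r0))
    (ler_wpM2l (ltW t0) (xlnx_ge_sub b0 r0))).
  by rewrite le_eqVlt; apply/orP; left; apply/eqP; rewrite /r; ring.
rewrite negb_or -!leNgt => /andP[a0' b0'].
have -> : a = 0 by apply: le_anti; rewrite a0 a0'.
have -> : b = 0 by apply: le_anti; rewrite b0 b0'.
by rewrite jensen_gap_refl.
Qed.

Lemma jensen_gap_sum (I : finType) (P : pred I) (a b : I -> R) t :
  0 < t < 1 -> (forall i, P i -> 0 <= a i) -> (forall i, P i -> 0 <= b i) ->
  (forall i, P i -> (0 < a i) || (0 < b i)) ->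
  jensen_gap t (\sum_(i | P i) a i) (\sum_(i | P i) b i) <=
  \sum_(i | P i) jensen_gap t (a i) (b i).
Proof.
move=> t01 a0 b0 ab; have /andP[s0 _] := onem01 t01; have /andP[t0 _] := t01.
rewrite /jensen_gap big_split /= -!mulr_sumr.
have -> : (1 - t) * (\sum_(i | P i) a i) + t * (\sum_(i | P i) b i) =
    \sum_(i | P i) ((1 - t) * a i + t * b i).
  by rewrite big_split /= -!mulr_sumr.
have r0 i : P i -> 0 < (1 - t) * a i + t * b i.
  by move=> Pi; apply: mix_gt0; [|exact: a0|exact: b0|exact: ab].
by apply: lerD; (apply: ler_wpM2l; [exact: ltW|exact: log_sum]).
Qed.

(** Comparing [(a, b - v)] and [(a - v, b)] with their mixture: they are at
    distance [t * v] and [(1 - t) * v] from it, so Pinsker's bounds weighted by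
    [1 - t] and [t] add up to the factor [t * (1 - t)]. *)
Lemma jensen_gap_pinsker t a b v : 0 < t < 1 -> 0 < a -> 0 < b ->
  v <= a -> v <= b ->
  2 * (t * (1 - t)) * v ^+ 2 / (a + b - v) <=
  jensen_gap t a (a - v) + jensen_gap t (b - v) b.
Proof.
move=> t01 a0 b0 va vb.
have /andP[s0 _] := onem01 t01; have /andP[t0 _] := t01.
have av0 : 0 <= a - v by rewrite subr_ge0.
have bv0 : 0 <= b - v by rewrite subr_ge0.
have r1 : 0 < (1 - t) * a + t * (a - v).
  by apply: mix_gt0 => //; [exact: ltW|rewrite a0].
have r2 : 0 < (1 - t) * (b - v) + t * b.
  by apply: mix_gt0 => //; [exact: ltW|rewrite b0 orbT].
rewrite /jensen_gap.
set r := (1 - t) * a + t * (a - v) in r1 *.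
set r' := (1 - t) * (b - v) + t * b in r2 *.
have e1 : a + (b - v) = r + r' by rewrite /r /r'; ring.
have e2 : (a - v) + b = r + r' by rewrite /r /r'; ring.
have := pinsker2 (ltW a0) bv0 r1 r2 e1.
have := pinsker2 av0 (ltW b0) r1 r2 e2.
rewrite e1 e2.
have -> : a + b - v = r + r' by rewrite /r /r'; ring.
have -> : a - r = t * v by rewrite /r; ring.
have -> : a - v - r = - ((1 - t) * v) by rewrite /r; ring.
rewrite -(ler_pM2l t0) => p1; rewrite -(ler_pM2l s0) => p2.
have := lerD p1 p2; set m := (r + r')^-1.
have -> : t * (2 * (- ((1 - t) * v)) ^+ 2 * m) +
    (1 - t) * (2 * (t * v) ^+ 2 * m) = 2 * (t * (1 - t)) * v ^+ 2 * m by ring.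
by move=> /le_trans; apply; rewrite le_eqVlt; apply/orP; left; apply/eqP; ring.
Qed.

End JensenGap.

(** * The costs [h_t] and [k_t] *)

Section PerspectiveCost.
Context {R : realType}.
Implicit Types a b c d t u v x y : R.

(** Taking the larger mass [a] itself as the reference in [jensen_gapE] turns
    the gap into a function of the lost fraction [(a - b) / a] alone. *)
Lemma htE t a b : 0 < t < 1 -> 0 < a -> 0 <= b <= a ->
  (ht t ((a - b) / a) * a%:E = (2 / (t * (1 - t)) * jensen_gap t a b)%:E)%E.
Proof.
move=> t01 a0 /andP[b0 ba].
have /andP[s0 _] := onem01 t01; have /andP[t0 t1] := t01.
have u1 : (a - b) / a <= 1 by rewrite ler_pdivrMr// mul1r gerBl.
have tu1 : t * ((a - b) / a) <= 1.
  rewrite (le_trans (ler_wpM2l (ltW t0) u1))// mulr1; exact: ltW.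
rewrite /ht /h u1 tu1 -!EFinM; congr EFin.
have -> : 1 - (a - b) / a = b / a by field; rewrite gt_eqF.
have -> : 1 - t * ((a - b) / a) = ((1 - t) * a + t * b) / a.
  by field; rewrite gt_eqF.
rewrite (@jensen_gapE _ t a b a t01 (ltW a0) b0 a0) divff ?gt_eqF// ln1.
by field; rewrite !gt_eqF.
Qed.

Lemma ht_neqNy t u : 0 < t < 1 -> ht t u != -oo%E.
Proof.
move=> /andP[t0 t1]; rewrite /ht; case: ifP => // u1.
have tu1 : t * u <= 1 by rewrite (le_trans (ler_wpM2l (ltW t0) u1))// mulr1 ltW.
by rewrite /h u1 tu1.
Qed.

Lemma pht_neqNy t c u : 0 < t < 1 -> 0 < c -> (c%:E * ht t u != -oo)%E.
Proof.
move=> t01 c0; move: (ht_neqNy u t01).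
by case: (ht t u) => //= _; rewrite gt0_muley// lte_fin.
Qed.

Lemma kt_ge t v : 0 < t < 1 -> 0 <= v <= 1 / 2 ->
  ((4 * v ^+ 2 / (1 - v))%:E <= kt t v)%E.
Proof.
move=> t01 /andP[v0 v2]; apply: le_ereal_inf_tmp => _ [a [b [a0 b0 ab1 ->]]].
have s01 := onem01 t01.
have /andP[s0 _] := s01; have /andP[t0 _] := t01.
have big c s : 0 < s < 1 -> 0 < c -> ~~ (v <= c) -> (c%:E * ht s (v / c) = +oo)%E.
  move=> _ c0 vc; rewrite /ht ifF; last first.
    by apply/negbTE; rewrite ler_pdivrMr// mul1r.
  by rewrite gt0_muley// lte_fin.
have [va|va] := boolP (v <= a); last first.
  by rewrite big// addye ?leey// pht_neqNy.
have [vb|vb] := boolP (v <= b); last first.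
  by rewrite (big b)// addey ?leey// pht_neqNy.
have -> : v / a = (a - (a - v)) / a by rewrite subKr.
have -> : v / b = (b - (b - v)) / b by rewrite subKr.
rewrite ![(_%:E * ht _ _)%E]muleC !htE//; last 2 first.
- by rewrite subr_ge0 vb gerBl.
- by rewrite subr_ge0 va gerBl.
rewrite jensen_gap_sym.
have -> : 1 - (1 - t) = t by ring.
rewrite -EFinD lee_fin [(1 - t) * t]mulrC -mulrDr.
have c0 : 0 < 2 / (t * (1 - t)) by rewrite divr_gt0// mulr_gt0.
have := jensen_gap_pinsker t01 a0 b0 va vb.
rewrite -(ler_pM2l c0); apply: le_trans.
have m0 : 0 < a + b - v by lra.
have -> : 2 / (t * (1 - t)) * (2 * (t * (1 - t)) * v ^+ 2 / (a + b - v)) =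
   4 * v ^+ 2 / (a + b - v) by field; rewrite !gt_eqF.
apply: ler_wpM2l; first by rewrite mulr_ge0// sqr_ge0.
by rewrite lef_pV2 ?posrE//; lra.
Qed.

(** Rescaling by the total mass [m] removes the normalisation of the pairs
    [(alpha, beta)] over which the infimum [k_t] is taken. *)
Lemma kt_le t v m a b : 0 < t < 1 -> 0 < a -> 0 < b -> a + b <= m ->
  (m%:E * kt t (v / m) <=
   a%:E * ht t (v / a) + b%:E * ht (1 - t) (v / b))%E.
Proof.
move=> t01 a0 b0 abm; have m0 : 0 < m := lt_le_trans (addr_gt0 a0 b0) abm.
rewrite -lee_pdivlMl//; apply: ereal_inf_lbound.
exists (a / m), (b / m); split; rewrite ?divr_gt0//.
  by rewrite -mulrDl ler_pdivrMr// mul1r.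
have e c : 0 < c -> v / m / (c / m) = v / c.
  by move=> c0; field; rewrite !gt_eqF.
rewrite !e// muleDr//; last first.
  rewrite /adde_def; apply/andP; split.
    by rewrite negb_and (pht_neqNy _ (onem01 t01))// orbT.
  by rewrite negb_and (pht_neqNy _ t01).
by rewrite !muleA -!EFinM [_^-1 * a]mulrC [_^-1 * b]mulrC.
Qed.

End PerspectiveCost.

(** * The heat kernel of the complete graph *)

Section Semigroup.
Context {R : realType} {X : finType}.
Context (mu : X -> R) (mu_prob : is_prob mu).
Implicit Types x y z : X.

Lemma generatorE x y : generator mu x y = mu y - (x == y)%:R.
Proof.
by rewrite /generator; case: eqVneq => [->|_]; rewrite ?opprB// subr0.
Qed.

(** The generator is [M - I], where all the rows of [M] are [mu]. As [M] is a
    projection, so is [I - M], and its powers are constant except for the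
    zeroth. *)
Lemma ker_pow_generator c k x y :
  ker_pow (fun x y => c * generator mu x y) k x y =
  (- c) ^+ k * ((x == y)%:R - mu y) + (k == 0)%N%:R * mu y.
Proof.
elim: k x y => [|k IH] x y.
  by rewrite /ker_pow /= /ker_id expr0 !mul1r subrK.
rewrite /ker_pow iterS -/(ker_pow _ k) /ker_mul.
transitivity (\sum_z ((c * (- c) ^+ k) * (generator mu x z * (z == y)%:R) +
    c * ((k == 0)%N%:R - (- c) ^+ k) * mu y * generator mu x z)).
  by apply: eq_bigr => z _; rewrite IH; ring.
rewrite big_split /= -!mulr_sumr.
have -> : \sum_z generator mu x z = 0.
  under eq_bigr do rewrite generatorE.
  rewrite sumrB mu_prob.2 (bigD1 x)//= eqxx big1 ?addr0 ?subrr// => z zx.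
  by rewrite eq_sym (negbTE zx).
rewrite (bigD1 y)//= eqxx big1 => [|z /negbTE ->]; last by rewrite mulr0.
by rewrite generatorE exprS /=; ring.
Qed.

Lemma semigroupE gamma x y :
  semigroup mu gamma 1 x y =
  expR (- gamma) * ((x == y)%:R - mu y) + mu y.
Proof.
rewrite /semigroup /ker_exp mulr1; apply: cvg_lim => //.
rewrite -(cvg_shiftS (fun n => _)) /=.
have -> : (fun n => \sum_(0 <= k < n.+1)
      ker_pow (fun x y => gamma * generator mu x y) k x y / k`!%:R) =
    (fun n => series (exp_coeff (- gamma)) n.+1 * ((x == y)%:R - mu y) + mu y).
  apply/funext => n.
  transitivity (\sum_(0 <= k < n.+1) (exp_coeff (- gamma) k * ((x == y)%:R - mu y)
       + (k == 0)%N%:R / k`!%:R * mu y)).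
    by apply: eq_bigr => k _; rewrite ker_pow_generator /exp_coeff /=; ring.
  rewrite big_split /= -!mulr_suml; congr (_ + _).
  rewrite big_nat_recl// big1 ?addr0 => [|k _]; last by rewrite mul0r.
  by rewrite fact0 divr1 mul1r.
apply: cvgD; last exact: cvg_cst.
apply: cvgMl; rewrite (cvg_shiftS (series (exp_coeff (- gamma)))).
exact: is_cvg_series_exp_coeff.
Qed.

End Semigroup.

(** * The zero-temperature coupling *)

Section ZeroTemperature.
Context {R : realType} {X : finType}.
Context (mu nu0 nu1 : X -> R).
Context (mu_prob : is_prob mu) (mu_gt0 : forall x, 0 < mu x).
Implicit Types (x y z : X) (pi : X -> X -> R) (f g : X -> R).

Lemma cvg_sumr (I : finType) (T : Type) (F : set_system T) {FF : Filter F}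
    (u : I -> T -> R) (l : I -> R) :
  (forall i, u i t @[t --> F] --> l i)%classic ->
  (\sum_i u i t @[t --> F] --> \sum_i l i)%classic.
Proof. by move=> ul; apply: cvg_big => // -[a b]; exact: add_continuous. Qed.

Lemma mu_le1 x : mu x <= 1.
Proof.
rewrite -mu_prob.2 (bigD1 x)//= lerDl sumr_ge0// => y _.
exact: mu_prob.1.
Qed.

Lemma semigroup_ge gamma x y :
  (1 - expR (- gamma)) * mu y <= semigroup mu gamma 1 x y.
Proof.
rewrite semigroupE// mulrBr mulrBl mul1r addrAC -addrA addrC -addrA.
by rewrite lerD2l [leRHS]addrC lerDr mulr_ge0// expR_ge0.
Qed.

Lemma semigroup_diag_ge gamma x : 0 < gamma ->
  expR (- gamma) <= semigroup mu gamma 1 x x.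
Proof.
move=> g0; rewrite semigroupE// eqxx mulrBr mulr1 -addrA lerDl.
rewrite addrC subr_ge0 ler_piMl ?(ltW (mu_gt0 _))//.
by rewrite expR_le1 oppr_le0 ltW.
Qed.

Lemma semigroup_ge0 gamma x y : 0 < gamma -> 0 <= semigroup mu gamma 1 x y.
Proof.
move=> g0; apply: le_trans (semigroup_ge gamma x y).
rewrite mulr_ge0 ?(ltW (mu_gt0 _))// subr_ge0.
by rewrite expR_le1 oppr_le0 ltW.
Qed.

Lemma schrodinger_coupling_is_coupling gamma f g : 0 < gamma ->
  schrodinger_system mu nu0 nu1 gamma f g ->
  is_coupling nu0 nu1 (schrodinger_coupling mu gamma f g).
Proof.
move=> g0 [f0 g0' Hf Hg]; split => [x y|x|y].
- by rewrite /schrodinger_coupling !mulr_ge0// ?(ltW (mu_gt0 _))// semigroup_ge0.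
- rewrite -[RHS](divfK (lt0r_neq0 (mu_gt0 x))) -Hf /ker_app mulr_sumr mulr_suml.
  by apply: eq_bigr => y _; rewrite /schrodinger_coupling; ring.
- rewrite -[RHS](divfK (lt0r_neq0 (mu_gt0 y))) -Hg /ker_app mulr_sumr mulr_suml.
  apply: eq_bigr => x _; rewrite /schrodinger_coupling !semigroupE//.
  rewrite [y == x]eq_sym; by case: eqVneq => [->|_] /=; ring.
Qed.

(** The weights [mu], [f] and [g] occur in the same way in both products. What
    is left is a comparison of kernel entries: the two on the left are
    off-diagonal and carry a factor [1 - e^-gamma] each, whereas on the right
    the diagonal entry at [x] is at least [e^-gamma]. *)
Lemma schrodinger_coupling_exchange gamma f g x y z : 0 < gamma ->
  schrodinger_system mu nu0 nu1 gamma f g -> y != x -> z != x ->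
  let pi := schrodinger_coupling mu gamma f g in
  expR (- gamma) * (pi x y * pi z x) <=
  (1 - expR (- gamma)) * (pi x x * pi z y).
Proof.
move=> g0 [f0 g0' _ _] yx zx /=.
set e := expR (- gamma); set c := 1 - e.
have e0 : 0 <= e := expR_ge0 _.
have c0 : 0 <= c by rewrite /c subr_ge0 /e expR_le1 oppr_le0 ltW.
have offdiag a b : a != b -> semigroup mu gamma 1 a b = c * mu b.
  by move=> /negbTE ab; rewrite semigroupE// ab /c /e /=; ring.
have F0 : 0 <= mu x * mu z * f x * f z * g x * g y.
  by rewrite !mulr_ge0// ltW// mu_gt0.
rewrite /schrodinger_coupling (offdiag x y) 1?eq_sym// (offdiag z x)//.
have -> : e * (mu x * (c * mu y) * f x * g y * (mu z * (c * mu x) * f z * g x)) =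
  (mu x * mu z * f x * f z * g x * g y) * (mu x * (c * (e * (c * mu y)))) by ring.
have -> : c * (mu x * semigroup mu gamma 1 x x * f x * g x *
     (mu z * semigroup mu gamma 1 z y * f z * g y)) =
  (mu x * mu z * f x * f z * g x * g y) *
   (c * (semigroup mu gamma 1 x x * semigroup mu gamma 1 z y)) by ring.
apply: ler_wpM2l => //.
have B0 : 0 <= c * (e * (c * mu y)) by rewrite !mulr_ge0// ltW.
apply: le_trans (ler_piMl B0 (mu_le1 x)) _.
apply: ler_wpM2l => //; apply: ler_pM => //.
- by rewrite mulr_ge0// ltW.
- exact: semigroup_diag_ge.
- exact: semigroup_ge.
Qed.

Lemma zero_temperature_is_coupling pi :
  zero_temperature_coupling mu nu0 nu1 pi -> is_coupling nu0 nu1 pi.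
Proof.
move=> [f [g [Hsys Hcvg]]].
have Hc : (\forall gamma \near 0^'+,
    is_coupling nu0 nu1 (schrodinger_coupling mu gamma (f gamma) (g gamma)))%classic.
  near=> gamma; have g0 : 0 < gamma by near: gamma; exact: nbhs_right_gt.
  exact: schrodinger_coupling_is_coupling (Hsys _ g0).
split => [x y|x|y].
- apply: ler_cvg_to (cvg_cst 0) (Hcvg x y) _.
  by apply: filterS Hc => gamma [].
- have L := cvg_sumr (FF := at_right_proper_filter 0) (Hcvg x).
  rewrite -(cvg_lim _ L)//; apply: cvg_lim => //; apply: cvg_near_cst.
  by apply: filterS Hc => gamma [].
- have L := cvg_sumr (FF := at_right_proper_filter 0) (fun x => Hcvg x y).
  rewrite -(cvg_lim _ L)//; apply: cvg_lim => //; apply: cvg_near_cst.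
  by apply: filterS Hc => gamma [].
Unshelve. all: by end_near. Qed.

Lemma zero_temperature_exchange pi x y z :
  zero_temperature_coupling mu nu0 nu1 pi -> y != x -> z != x ->
  pi x y * pi z x <= 0.
Proof.
move=> [f [g [Hsys Hcvg]]] yx zx.
have He : (expR (- gamma) @[gamma --> 0^'+] --> (1 : R))%classic.
  have C : {for (0 : R), continuous (fun gamma : R => expR (- gamma))}.
    by apply: continuous_comp; [exact: opp_continuous|exact: continuous_expR].
  by move: C; rewrite /prop_for /continuous_at oppr0 expR0 => /cvg_at_right_filter.
pose P gamma := schrodinger_coupling mu gamma (f gamma) (g gamma).
have L : (expR (- gamma) * (P gamma x y * P gamma z x) @[gamma --> 0^'+] -->
    1 * (pi x y * pi z x))%classic.
  by apply: cvgM He _; apply: cvgM; exact: Hcvg.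
have U : ((1 - expR (- gamma)) * (P gamma x x * P gamma z y) @[gamma --> 0^'+]
    --> (1 - 1) * (pi x x * pi z y))%classic.
  apply: cvgM; first by apply: cvgB He; exact: cvg_cst.
  by apply: cvgM; exact: Hcvg.
rewrite -[leLHS]mul1r -[leRHS](mul0r (pi x x * pi z y)) -[X in _ <= X * _](subrr 1).
apply: ler_cvg_to L U _.
near=> gamma; have g0 : 0 < gamma by near: gamma; exact: nbhs_right_gt.
exact: schrodinger_coupling_exchange (Hsys _ g0) yx zx.
Unshelve. all: by end_near. Qed.

(** Each product of a mass leaving [x] with a mass entering [x] vanishes, hence
    so does the product of the total outgoing and incoming masses. One of these
    totals is zero, and the corresponding marginal stays entirely at [x]. *)
Lemma zero_temperature_diag pi x :
  zero_temperature_coupling mu nu0 nu1 pi -> pi x x = Num.min (nu0 x) (nu1 x).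
Proof.
move=> Hpi; have [pi0 E0 E1] := zero_temperature_is_coupling Hpi.
have D0 : nu0 x = pi x x + \sum_(y | y != x) pi x y by rewrite -E0 (bigD1 x).
have D1 : nu1 x = pi x x + \sum_(z | z != x) pi z x by rewrite -E1 (bigD1 x).
set a := \sum_(y | _) pi x y in D0; set b := \sum_(z | _) pi z x in D1.
have a0 : 0 <= a by rewrite sumr_ge0.
have b0 : 0 <= b by rewrite sumr_ge0.
have ab : a * b = 0.
  rewrite mulr_suml; apply: big1 => y yx; rewrite mulr_sumr; apply: big1 => z zx.
  apply: le_anti; rewrite mulr_ge0// andbT.
  exact: zero_temperature_exchange Hpi yx zx.
rewrite D0 D1 -addr_minr; have /eqP := ab; rewrite mulf_eq0.
move=> /orP[]/eqP ->; first by rewrite min_l// addr0.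
by rewrite min_r// addr0.
Qed.

End ZeroTemperature.

(** * Transport cost, entropy and the convexity defect *)

Section Transport.
Context {R : realType} {X : finType}.
Context (nu0 nu1 : X -> R).
Implicit Types (x y z : X) (pi : X -> X -> R).

Lemma transport_costE pi : is_coupling nu0 nu1 pi ->
  \sum_x \sum_y dist x y * pi x y = \sum_x (nu0 x - pi x x).
Proof.
move=> [_ E0 _]; apply: eq_bigr => x _.
rewrite -E0 (bigD1 x)//= [in RHS](bigD1 x)//= /dist eqxx mul0r add0r [RHS]addrC addKr.
by apply: eq_bigr => y; rewrite eq_sym => ->; rewrite mul1r.
Qed.

Lemma coupling_diag_le pi x : is_coupling nu0 nu1 pi ->
  pi x x <= Num.min (nu0 x) (nu1 x).
Proof.
move=> [pi0 E0 E1]; rewrite le_min -E0 -E1; apply/andP; split.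
  by rewrite (bigD1 x)//= lerDl sumr_ge0.
by rewrite (bigD1 x)//= lerDl sumr_ge0.
Qed.

(** The cost of a coupling is the mass off its diagonal, and no coupling keeps
    more than the minimum of the marginals in place. *)
Lemma W1E pi : is_coupling nu0 nu1 pi ->
  (forall x, pi x x = Num.min (nu0 x) (nu1 x)) ->
  W1 nu0 nu1 = \sum_x (nu0 x - Num.min (nu0 x) (nu1 x)).
Proof.
move=> Hpi diag.
set m := \sum_x _.
have lb : lbound [set c | exists2 pi, is_coupling nu0 nu1 pi
    & c = \sum_x \sum_y dist x y * pi x y]%classic m.
  move=> _ [pi' Hpi' ->]; rewrite transport_costE//; apply: ler_sum => x _.
  by rewrite lerD2l lerN2; exact: coupling_diag_le.
have attained : [set c | exists2 pi, is_coupling nu0 nu1 pi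
    & c = \sum_x \sum_y dist x y * pi x y]%classic m.
  by exists pi => //; rewrite transport_costE//; apply: eq_bigr => x _; rewrite diag.
apply: le_anti; apply/andP; split; first by apply: ge_inf => //; exists m.
by apply: lb_le_inf => //; exists m.
Qed.

Lemma bridgeE pi t z : is_coupling nu0 nu1 pi ->
  bridge pi t z = (1 - t) * nu0 z + t * nu1 z.
Proof.
move=> [_ E0 E1]; rewrite /bridge /dirac_bridge.
transitivity (\sum_x \sum_y ((1 - t) * ((z == x)%:R * pi x y))
   + \sum_x \sum_y (t * ((z == y)%:R * pi x y))).
  rewrite -big_split /=; apply: eq_bigr => x _.
  by rewrite -big_split /=; apply: eq_bigr => y _; ring.
congr (_ + _).
  rewrite (bigD1 z)//= [X in _ + X]big1 ?addr0 => [|x]; last first.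
    by rewrite eq_sym => /negbTE ->; apply: big1 => y _; rewrite mul0r mulr0.
  by rewrite -E0 mulr_sumr; apply: eq_bigr => y _; rewrite eqxx mul1r.
rewrite -E1 mulr_sumr; apply: eq_bigr => x _.
rewrite (bigD1 z)//= [X in _ + X]big1 ?addr0 => [|y]; last first.
  by rewrite eq_sym => /negbTE ->; rewrite mul0r mulr0.
by rewrite eqxx mul1r.
Qed.

Context (nu0_ge0 : forall x, 0 <= nu0 x) (nu1_ge0 : forall x, 0 <= nu1 x).

(** Each site [x] keeps [m x = min (nu0 x) (nu1 x)]. It contributes the gap
    between [nu0 x] and [m x] to the forward integral and the gap between [m x]
    and [nu1 x] to the backward one. One of the two is trivial and the other is
    the gap between [nu0 x] and [nu1 x]. *)
Lemma CtE pi t : 0 < t < 1 -> is_coupling nu0 nu1 pi ->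
  (forall x, pi x x = Num.min (nu0 x) (nu1 x)) ->
  Ct nu0 nu1 pi t =
    (2 / (t * (1 - t)) * \sum_x jensen_gap t (nu0 x) (nu1 x))%:E.
Proof.
move=> t01 [_ E0 E1] diag; set c := 2 / _.
pose m x := Num.min (nu0 x) (nu1 x).
have m_ge0 x : 0 <= m x by rewrite /m le_min nu0_ge0 nu1_ge0.
have m_le0 x : m x <= nu0 x by rewrite /m ge_min lexx.
have m_le1 x : m x <= nu1 x by rewrite /m ge_min lexx orbT.
have moved0 x : \sum_w (w != x)%:R * ker_fwd nu0 pi w x = (nu0 x - m x) / nu0 x.
  rewrite /m -diag -[X in X - _]E0 /ker_fwd.
  rewrite (bigD1 x)//= eqxx mul0r add0r [in RHS](bigD1 x)//= [X in X / _]addrC addKr.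
  by rewrite mulr_suml; apply: eq_bigr => w ->; rewrite mul1r.
have moved1 y : \sum_w (w != y)%:R * ker_bwd nu1 pi w y = (nu1 y - m y) / nu1 y.
  rewrite /m -diag -[X in X - _]E1 /ker_bwd.
  rewrite (bigD1 y)//= eqxx mul0r add0r [in RHS](bigD1 y)//= [X in X / _]addrC addKr.
  by rewrite mulr_suml; apply: eq_bigr => w ->; rewrite mul1r.
have S0 : (\sum_(x | (0 < nu0 x)%R)
    ht t (\sum_w (w != x)%:R * ker_fwd nu0 pi w x)%R * (nu0 x)%:E)%E =
    (\sum_x c * jensen_gap t (nu0 x) (m x))%:E.
  rewrite big_mkcond -sumEFin; apply: eq_bigr => x _; case: ifPn => [x0|].
    by rewrite moved0 htE// m_ge0 m_le0.
  rewrite -leNgt => x0.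
  have -> : m x = nu0 x.
    by apply: le_anti; rewrite m_le0 (le_trans x0).
  by rewrite jensen_gap_refl mulr0.
have S1 : (\sum_(y | (0 < nu1 y)%R)
    ht (1 - t) (\sum_w (w != y)%:R * ker_bwd nu1 pi w y)%R * (nu1 y)%:E)%E =
    (\sum_x c * jensen_gap t (m x) (nu1 x))%:E.
  rewrite big_mkcond -sumEFin; apply: eq_bigr => x _; case: ifPn => [x0|].
    rewrite moved1 htE ?onem01//; last by rewrite m_ge0 m_le1.
    by rewrite jensen_gap_sym subKr mulrC [(1 - t) * t]mulrC mulrC.
  rewrite -leNgt => x0.
  have -> : m x = nu1 x.
    by apply: le_anti; rewrite m_le1 (le_trans x0).
  by rewrite jensen_gap_refl mulr0.
rewrite /Ct S0 S1 -EFinD -big_split mulr_sumr /=; congr EFin.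
apply: eq_bigr => x _; rewrite -mulrDr /m; congr (_ * _).
case: leP => _; first by rewrite jensen_gap_refl add0r.
by rewrite jensen_gap_refl addr0.
Qed.

Lemma rel_entropy_gap mu pi t : 0 < t < 1 -> (forall x, 0 < mu x) ->
  is_coupling nu0 nu1 pi ->
  rel_entropy (bridge pi t) mu =
  (1 - t) * rel_entropy nu0 mu + t * rel_entropy nu1 mu
  - \sum_x jensen_gap t (nu0 x) (nu1 x).
Proof.
move=> t01 mu_gt0 Hpi; rewrite /rel_entropy !mulr_sumr -big_split /= -sumrB.
apply: eq_bigr => x _; rewrite (bridgeE _ _ Hpi).
by rewrite (jensen_gapE t01 (nu0_ge0 x) (nu1_ge0 x) (mu_gt0 x)) subKr.
Qed.

(** The sites losing mass and the sites gaining mass are merged into one site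
    each, which by [jensen_gap_sum] can only decrease the gap. *)
Lemma jensen_gap_ge_kt t : 0 < t < 1 -> \sum_x nu0 x = 1 -> \sum_x nu1 x = 1 ->
  let w := \sum_x (nu0 x - Num.min (nu0 x) (nu1 x)) in
  ((1 + w)%:E * kt t (w / (1 + w)) <=
   (2 / (t * (1 - t)) * \sum_x jensen_gap t (nu0 x) (nu1 x))%:E)%E.
Proof.
move=> t01 s0 s1 /=; set w := \sum_x _; set c := 2 / _.
have c0 : 0 <= c.
  have /andP[u0 _] := onem01 t01; have /andP[t0 _] := t01.
  by rewrite divr_ge0// mulr_ge0// ltW.
have w_ge0 : 0 <= w by apply: sumr_ge0 => x _; rewrite subr_ge0 ge_min lexx.
have [w0|] := ltP 0 w; last first.
  (* The merged masses may vanish when [w = 0]. Any admissible pair will do then,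
     since [h_t 0 = 0]. *)
  move=> w_le0; have -> : w = 0 by apply: le_anti; rewrite w_ge0 w_le0.
  have h0 : 0 < (1 / 2 : R) by [].
  apply: le_trans (kt_le 0 t01 h0 h0 _) _; first lra.
  have -> : 0 / (1 / 2) = (1 / 2 - 1 / 2) / (1 / 2) :> R by rewrite subrr.
  rewrite ![(_%:E * ht _ _)%E]muleC !htE ?onem01 ?lexx ?(ltW h0)//.
  rewrite !jensen_gap_refl !mulr0 -EFinD addr0 lee_fin mulr_ge0//.
  by apply: sumr_ge0 => x _; exact: jensen_gap_ge0.
pose P x := nu1 x < nu0 x; pose Q x := nu0 x < nu1 x.
set A := \sum_(x | P x) nu0 x; set A' := \sum_(x | P x) nu1 x.
set B := \sum_(x | Q x) nu1 x; set B' := \sum_(x | Q x) nu0 x.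
have wA : w = A - A'.
  rewrite /w /A /A' -sumrB [RHS]big_mkcond /=; apply: eq_bigr => x _.
  by rewrite /P; case: leP => _ //; rewrite subrr.
have wB : w = B - B'.
  have -> : w = \sum_x (nu1 x - Num.min (nu0 x) (nu1 x)).
    by rewrite /w !sumrB s0 s1.
  rewrite /B /B' -sumrB [RHS]big_mkcond /=; apply: eq_bigr => x _.
  by rewrite /Q minC; case: leP => _ //; rewrite subrr.
have A'0 : 0 <= A' by apply: sumr_ge0.
have B'0 : 0 <= B' by apply: sumr_ge0.
have A0 : 0 < A by lra.
have B0 : 0 < B by lra.
have AB : A + B <= 1 + w.
  rewrite -s1 /A /B /w [X in X + _ <= _]big_mkcond [X in _ + X <= _]big_mkcond /=.
  rewrite -!big_split /=; apply: ler_sum => x _.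
  rewrite /P /Q; have := nu0_ge0 x; have := nu1_ge0 x.
  by case: ltgtP => e; lra.
have gap : jensen_gap t A A' + jensen_gap t B' B <=
    \sum_x jensen_gap t (nu0 x) (nu1 x).
  have gA : jensen_gap t A A' <= \sum_(x | P x) jensen_gap t (nu0 x) (nu1 x).
    apply: jensen_gap_sum => // x Px.
    by rewrite (le_lt_trans (nu1_ge0 x) Px).
  have gB : jensen_gap t B' B <= \sum_(x | Q x) jensen_gap t (nu0 x) (nu1 x).
    apply: jensen_gap_sum => // x Qx.
    by rewrite (le_lt_trans (nu0_ge0 x) Qx) orbT.
  apply: le_trans (lerD gA gB) _.
  rewrite [X in X + _ <= _]big_mkcond [X in _ + X <= _]big_mkcond /= -big_split /=.
  apply: ler_sum => x _; have := jensen_gap_ge0 t01 (nu0_ge0 x) (nu1_ge0 x).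
  by rewrite /P /Q; case: ltgtP => e; lra.
apply: le_trans (kt_le w t01 A0 B0 AB) _.
rewrite ![(_%:E * ht _ _)%E]muleC {1}wA wB !htE ?onem01//; last 2 first.
- by apply/andP; split => //; lra.
- by apply/andP; split => //; lra.
rewrite jensen_gap_sym subKr [(1 - t) * t]mulrC -/c -EFinD -mulrDr lee_fin.
exact: ler_wpM2l.
Qed.

End Transport.

Theorem theorem2p4 (R : realType) (X : finType) (mu : X -> R)
    (mu_prob : is_prob mu) (mu_gt0 : forall x, 0 < mu x) :
  (forall (nu0 nu1 : X -> R) (pihat : X -> X -> R),
     is_prob nu0 -> is_prob nu1 ->
     zero_temperature_coupling mu nu0 nu1 pihat ->
     forall t : R, 0 < t < 1 ->
       ((rel_entropy (bridge pihat t) mu)%:E <=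
          ((1 - t) * rel_entropy nu0 mu + t * rel_entropy nu1 mu)%:E
          - (t * (1 - t) / 2)%:E * Ct nu0 nu1 pihat t)%E /\
       ((1 + W1 nu0 nu1)%:E * kt t (W1 nu0 nu1 / (1 + W1 nu0 nu1))
          <= Ct nu0 nu1 pihat t)%E) /\
  (forall t v : R, 0 < t < 1 -> 0 <= v <= 1 / 2 ->
     ((4 * v ^+ 2 / (1 - v))%:E <= kt t v)%E).
Proof.
split; last by move=> t v; exact: kt_ge.
move=> nu0 nu1 pihat [nu0_ge0 s0] [nu1_ge0 s1] Hpi t t01.
have Hc := zero_temperature_is_coupling mu_prob mu_gt0 Hpi.
have diag x := zero_temperature_diag mu_prob mu_gt0 x Hpi.
rewrite (CtE nu0_ge0 nu1_ge0 t01 Hc diag) (W1E Hc diag); split.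
  rewrite (rel_entropy_gap nu0_ge0 nu1_ge0 t01 mu_gt0 Hc).
  rewrite -EFinM -EFinB lee_fin lerD2l lerN2 mulrA.
  have /andP[u0 _] := onem01 t01; have /andP[t0 _] := t01.
  have -> : t * (1 - t) / 2 * (2 / (t * (1 - t))) = 1 by field; rewrite !gt_eqF.
  by rewrite mul1r.
exact: jensen_gap_ge_kt.
Qed.
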